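(* Let $H$ be a real Hilbert space and $f:H\to\mathbb{R}\cup\{+\infty\}$ a lower semicontinuous proper convex function with $\inf f=0$. The following statements are equivalent: (i) There exist $r_0>0$ and $\varphi\in\mathcal{K}(0,r_0)$ such that $\|\partial(\varphi\circ f)(x)\|_-\ge1$ for all $x\in[0<f\le r_0]$. (ii) There exists a concave function $\psi\in\mathcal{K}(0,\infty)$ such that $\|\partial(\psi\circ f)(x)\|_-\ge1$ for all $x\notin[f=0]$.
   Context: $\partial g$ denotes the Fréchet subdifferential: $p\in\partial g(x)$ ($x\in\operatorname{dom}g$) iff $\liminf_{y\to x,y\ne x}\frac{g(y)-g(x)-\langle p,y-x\rangle}{\|y-x\|}\ge0$, and $\partial g(x)=\emptyset$ outside $\operatorname{dom}g$. $\|C\|_-=\inf\{\|p\|:p\in C\}$, equal to $+\infty$ if $C=\emptyset$. $\mathcal{K}(0,\bar r)$ ($\bar r\in(0,+\infty]$): functions $\varphi\in C([0,\bar r))\cap C^1(0,\bar r)$ with $\varphi(0)=0$ and $\varphi'>0$ on $(0,\bar r)$. $[0<f\le r_0]=\{x:0<f(x)\le r_0\}$. *)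

(* Defs.v *)
From HB Require Import structures.
From mathcomp Require Import all_boot all_order all_algebra.
From mathcomp Require Import all_classical all_reals all_analysis.
Set Implicit Arguments. Unset Strict Implicit. Unset Printing Implicit Defensive.
Import Order.TTheory GRing.Theory Num.Theory.
Import numFieldNormedType.Exports.
Local Open Scope classical_set_scope.
Local Open Scope ring_scope.

(* A real Hilbert space: a complete normed space V over R together with an
   inner product [inner] whose induced norm is the norm of V. *)
Definition is_inner_product (R : realType) (V : completeNormedModType R)
    (inner : V -> V -> R) : Prop :=
  [/\ (forall x y, inner x y = inner y x),
      (forall a x y z, inner (a *: x + y) z = a * inner x z + inner y z),
      (forall x, 0 <= inner x x) &
      (forall x, `|x| = Num.sqrt (inner x x))].

Section defs.
Context {R : realType} {V : completeNormedModType R}.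
Local Open Scope ereal_scope.

Definition proper_fun (f : V -> \bar R) : Prop :=
  (forall x, f x != -oo) /\ (exists x, f x \is a fin_num).

Definition convex_efun (f : V -> \bar R) : Prop :=
  forall (x y : V) (t : R), (0 <= t <= 1)%R -> f x < +oo -> f y < +oo ->
    f (t *: x + (1 - t) *: y)%R <= t%:E * f x + (1 - t)%R%:E * f y.

Definition frechet_subdiff (inner : V -> V -> R) (g : V -> \bar R) (x : V)
  : set V :=
  [set p | g x \is a fin_num /\
     0 <= limf_einf
       (fun y : V => (g y - g x - (inner p (y - x)%R)%:E) * ((`|(y - x)%R|)^-1)%:E)
       (x^' : set_system V)].

(* ||C||_- = inf of norms, +oo if C is empty *)
Definition inf_norm (C : set V) : \bar R :=
  ereal_inf [set (`|p|)%:E | p in C].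

(* phi o f, for phi defined on [0, rbar): equal to +oo where f x is
   outside [0, rbar) (so such points lie outside the domain). *)
Definition compK (rbar : \bar R) (phi : R -> R) (f : V -> \bar R) : V -> \bar R :=
  fun x => if (0 <= f x) && (f x < rbar) then (phi (fine (f x)))%:E else +oo.

End defs.

Definition classK {R : realType} (rbar : \bar R) (phi : R -> R) : Prop :=
  [/\ {within [set t : R | 0 <= t /\ (t%:E < rbar)%E], continuous phi},
      phi 0 = 0 &
      forall t : R, 0 < t -> (t%:E < rbar)%E ->
        [/\ derivable phi t 1, {for t, continuous (derive1 phi)} & 0 < (derive1 phi) t]].

Definition concave_on_nonneg {R : realType} (psi : R -> R) : Prop :=
  forall s t l : R, 0 <= s -> 0 <= t -> 0 <= l <= 1 ->
    l * psi s + (1 - l) * psi t <= psi (l * s + (1 - l) * t).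

(* Main.v *)
Require Import Defs.
From HB Require Import structures.
From mathcomp Require Import all_boot all_order all_algebra.
From mathcomp Require Import all_classical all_reals all_analysis.
From mathcomp Require Import ring lra.
Set Implicit Arguments.
Unset Strict Implicit.
Unset Printing Implicit Defensive.
Import Order.TTheory GRing.Theory Num.Theory.
Import numFieldNormedType.Exports.
Local Open Scope classical_set_scope.
Local Open Scope ring_scope.

(* For convex [f] the Fréchet subdifferential of [phi \o f] at a point of level
   [a] is [phi' a] times the convex subdifferential of [f], so both conditions
   say that [phi' (f x) * |q| >= 1] for every subgradient [q] of [f] at [x].
   If [q] is a subgradient at [x] and [s <= f x], then projecting [x] onto
   [f <= s] gives a point of level [s] with a subgradient no longer than [q];
   hence [phi' s * |q| >= 1] for all small [s <= f x], and [phi'], frozen beyond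
   some level, may be replaced by its running infimum over [(0, r]]. The latter
   is continuous, nonincreasing and, being at most [phi'], integrable near [0];
   its primitive is the required concave function, up to adding the identity,
   which keeps the derivative positive where the running infimum vanishes. *)

Lemma ler_add_small_mul (R : realFieldType) (a b c : R) :
  (forall t, 0 < t <= 1 -> a <= b + t * c) -> a <= b.
Proof.
move=> ab; apply/ler_addgt0Pr => e e0.
have d0 : 0 < e + `|c| by rewrite ltr_wpDr.
have : 0 < e / (e + `|c|) <= 1.
  by rewrite divr_gt0//= ler_pdivrMr// mul1r lerDl.
move=> /ab/le_trans; apply; rewrite lerD2l mulrAC ler_pdivrMr// ler_pM2l//.
by rewrite (le_trans (ler_norm c))// lerDr ltW.
Qed.

Lemma le_EFin_ub (R : realDomainType) (a : R) (y : \bar R) :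
  (forall c, (y <= c%:E)%E -> a <= c) -> (a%:E <= y)%E.
Proof.
case: y => [y| |] ub; [by rewrite lee_fin ub|exact: leey|].
by have := ub (a - 1) (leNye _); rewrite lerBrDr gerDl ler10.
Qed.

Lemma limf_einf_geP (R : realType) (T : choiceType) (X : filteredType T)
    (h : X -> \bar R) (F : set_system X) (a : R) : Filter F ->
  (a%:E <= limf_einf h F)%E <->
  forall e : R, 0 < e -> \forall y \near F, ((a - e)%:E <= h y)%E.
Proof.
move=> FF; rewrite limf_einfE; split=> [ah e e0|ah].
  have : ((a - e)%:E < ereal_sup [set ereal_inf (h @` A) | A in F])%E.
    by apply: lt_le_trans ah; rewrite lte_fin gtrBl.
  move=> /ereal_sup_gt[_ [A FA <-] eA]; apply: filterS FA => y Ay /=.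
  by apply: (le_trans (ltW eA)); apply: ereal_inf_lbound; exists y.
apply/lee_addgt0Pr => e e0; rewrite -leeBlDr// -EFinB; apply: ereal_sup_ge.
exists (ereal_inf (h @` [set y | ((a - e)%:E <= h y)%E])).
  by exists [set y | ((a - e)%:E <= h y)%E] => //; exact: ah.
by apply/ereal_infP => _ [y /= hy <-].
Qed.

Section real_derivatives.
Variable R : realType.
Implicit Types f df : R -> R.

Lemma is_derive1_continuous f (t d : R) :
  is_derive t 1 f d -> {for t, continuous f}.
Proof. by move=> [df _]; exact/differentiable_continuous/derivable1_diffP. Qed.

Lemma is_derive1_ge_expansion f (t d : R) : is_derive t 1 f d ->
  forall e, 0 < e -> \forall s \near 0, f t + d * s - e * `|s| <= f (t + s).
Proof.
move=> [/derivable_nbhs dft <-] e e0.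
have /eqaddoP/(_ e e0) := dft; apply: filterS => s /=.
rewrite !fctE /= [_ *: 1]mulr1 [_ *: 'D_1 f t]mulrC (addrC s).
by rewrite ler_norml => /andP[+ _]; lra.
Qed.

Lemma is_derive1_ge0_homo f df (i : interval R) :
  {in i, forall x : R, is_derive x 1 f (df x)} -> {in i, forall x, 0 <= df x} ->
  {in i &, {homo f : x y / x <= y}}.
Proof.
move=> dfE df0 x y xi yi xy.
have sub z : z \in `[x, y] -> z \in i.
  by rewrite in_itv/=; exact: interval_is_interval.
have [||z /sub zi] := @MVT_segment R f df x y xy.
- by move=> z /subset_itv_oo_cc/sub/dfE.
- by apply: derivable_within_continuous => z /sub/dfE[].
by rewrite -subr_ge0 => ->; rewrite mulr_ge0 ?df0 ?subr_ge0.
Qed.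

Lemma derive_noninc_le_tangent f df (z u : R) :
  {within `[0, +oo[, continuous f} ->
  {in `]0, +oo[, forall x : R, is_derive x 1 f (df x)} ->
  {in `]0, +oo[ &, {homo df : x y /~ x <= y}} ->
  0 < z -> 0 <= u -> f u <= f z + df z * (u - z).
Proof.
move=> cf dfE df_noninc z0 u0.
have mvt a b : 0 <= a -> a < b ->
    exists2 c, a < c < b & f b - f a = df c * (b - a).
  move=> a0 ab; have [||c] := @MVT R f df a b ab.
  - move=> c; rewrite in_itv/= => /andP[ac _].
    by apply: dfE; rewrite in_itv/= andbT (le_lt_trans a0).
  - apply: continuous_subspaceW cf => c /=; rewrite !in_itv/= => /andP[ac _].
    by rewrite (le_trans a0).
  by rewrite in_itv/=; exists c.
have slope_le x y : 0 < x -> x <= y -> df y <= df x.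
  move=> x0 xy; apply: df_noninc; rewrite ?in_itv/= ?andbT//.
  exact: lt_le_trans xy.
have [uz|zu|->] := ltgtP u z; last by rewrite subrr mulr0 addr0.
- have [c /andP[uc cz] fE] := mvt u z u0 uz.
  have := slope_le c z (le_lt_trans u0 uc) (ltW cz); nra.
- have [c /andP[zc _] fE] := mvt z u (ltW z0) zu.
  have := slope_le z c z0 (ltW zc); nra.
Qed.

Lemma derive_noninc_concave f df :
  {within `[0, +oo[, continuous f} ->
  {in `]0, +oo[, forall x : R, is_derive x 1 f (df x)} ->
  {in `]0, +oo[ &, {homo df : x y /~ x <= y}} ->
  concave_on_nonneg f.
Proof.
move=> cf dfE df_noninc s t l s0 t0 /andP[l0 l1]; set z := l * s + _.
have l1' : 0 <= 1 - l by rewrite subr_ge0.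
have [z0|z0] := ltP 0 z.
  have tangent u := derive_noninc_le_tangent cf dfE df_noninc z0 (u := u).
  have := ler_wpM2l l0 (tangent s s0); have := ler_wpM2l l1' (tangent t t0).
  have : l * (df z * (s - z)) + (1 - l) * (df z * (t - z)) = 0.
    by rewrite /z; ring.
  lra.
have scale_eq0 k u : k * u = 0 -> k * f u = k * f 0.
  by move=> /eqP; rewrite mulf_eq0 => /orP[/eqP ->|/eqP -> //]; rewrite !mul0r.
have /eqP : z = 0 by apply/eqP; rewrite eq_le z0 addr_ge0// mulr_ge0.
rewrite paddr_eq0 ?mulr_ge0// => /andP[/eqP ls0 /eqP lt0].
by rewrite (scale_eq0 l)// (scale_eq0 (1 - l))// /z ls0 lt0 addr0; lra.
Qed.

End real_derivatives.

Section oriented_integral.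
Variable R : realType.
Notation mu := (@lebesgue_measure R).
Implicit Type f : R -> R.

Definition oriented_Rintegral f (c x : R) : R :=
  \int[mu]_(t in `[c, x]) f t - \int[mu]_(t in `[x, c]) f t.

Lemma oriented_Rintegral_chasles f (a b c x : R) :
  {within `[a, b], continuous f} -> c \in `[a, b] -> x \in `[a, b] ->
  oriented_Rintegral f c x =
  \int[mu]_(t in `[a, x]) f t - \int[mu]_(t in `[a, c]) f t.
Proof.
move=> cf cab xab; rewrite /oriented_Rintegral.
have split_at u v : u \in `[a, b] -> v \in `[a, b] -> u <= v ->
    \int[mu]_(t in `[a, v]) f t - \int[mu]_(t in `[a, u]) f t =
    \int[mu]_(t in `[u, v]) f t.
  rewrite !in_itv/= => /andP[au ub] /andP[av vb] uv.
  have fI w : w <= b -> mu.-integrable `[a, w] (EFin \o f).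
    move=> wb; apply: integrableS (continuous_compact_integrable _ cf) => //.
      by apply: subset_itvl; rewrite bnd_simp.
    exact: segment_compact.
  rewrite Rintegral_itvB ?bnd_simp//; last exact: fI.
  rewrite Rintegral_itv_obnd_cbnd//; apply: integrableS (fI v vb) => //.
  by apply: subset_itvr; rewrite bnd_simp.
have [cx|xc|<-] := ltgtP c x.
- rewrite (@set_itv_ge _ _ (BLeft x)) ?bnd_simp -?ltNge// Rintegral_set0 subr0.
  by rewrite split_at// ltW.
- rewrite (@set_itv_ge _ _ (BLeft c)) ?bnd_simp -?ltNge// Rintegral_set0 sub0r.
  by rewrite -split_at// ?opprB// ltW.
- by rewrite !subrr.
Qed.

Lemma is_derive_oriented_Rintegral f (a b c x : R) :
  {in `]a, b[, continuous f} -> c \in `]a, b[ -> x \in `]a, b[ ->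
  is_derive x 1 (oriented_Rintegral f c) (f x).
Proof.
rewrite !in_itv/= => cf /andP[ac cb] /andP[ax xb].
pose a' := (a + Num.min c x) / 2; pose b' := (b + Num.max c x) / 2.
have [aa' a'c a'x] : [/\ a < a', a' < c & a' < x].
  by rewrite /a' minEle; case: ifP => ?; split; lra.
have [bb' b'c b'x] : [/\ b' < b, c < b' & x < b'].
  by rewrite /b' maxEle; case: ifP => ?; split; lra.
have cf' : {within `[a', b'], continuous f}.
  apply: continuous_in_subspaceT => t; rewrite inE/= in_itv/= => /andP[a't tb'].
  by apply: cf; rewrite in_itv/= (lt_le_trans aa')//= (le_lt_trans tb').
pose F t := \int[mu]_(s in `[a', t]) f s.
apply: (@near_eq_is_derive _ _ _ (F - cst (F c))).
  near=> t; rewrite !fctE (@oriented_Rintegral_chasles _ a' b')//.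
  - by rewrite in_itv/= !ltW.
  - rewrite in_itv/=; apply/andP; split; apply: ltW; near: t.
      exact: lt_nbhsr.
    exact: lt_nbhsl.
have [||dF] := @continuous_FTC1_closed _ f a' x b' b'x _ a'x.
- by apply: continuous_compact_integrable; first exact: segment_compact.
- by apply: cf; rewrite in_itv/= ax.
rewrite derive1E => dFE; rewrite -[X in is_derive _ _ _ X]subr0.
by apply: is_deriveB; rewrite -dFE; exact: DeriveDef.
Unshelve. all: by end_near. Qed.

End oriented_integral.

Definition running_inf {R : realType} (g : R -> R) (r : R) : R :=
  inf [set g s | s in `]0, r]].

Section running_inf.
Variables (R : realType) (g : R -> R) (m : R).
Hypothesis m_le : forall s : R, 0 < s -> m <= g s.

Lemma running_inf_le (r s : R) : 0 < s <= r -> running_inf g r <= g s.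
Proof.
move=> sr; apply: ge_inf; last by exists s => //=; rewrite in_itv.
by exists m => _ [u /= + <-]; rewrite in_itv/= => /andP[u0 _]; exact: m_le.
Qed.

Lemma le_running_inf (r k : R) : 0 < r ->
  (forall s, 0 < s <= r -> k <= g s) -> k <= running_inf g r.
Proof.
move=> r0 kg; apply: lb_le_inf.
  by exists (g r), r => //=; rewrite in_itv/= r0 lexx.
by move=> _ [u /= + <-]; rewrite in_itv; exact: kg.
Qed.

Lemma running_inf_noninc :
  {in `]0, +oo[ &, {homo running_inf g : a b /~ a <= b}}.
Proof.
move=> b a; rewrite !in_itv/= !andbT => b0 a0 ab.
apply: le_running_inf => // s /andP[s0 sa].
by apply: running_inf_le; rewrite s0 (le_trans sa).
Qed.

Lemma running_inf_modulus (a b e : R) : 0 < a -> a <= b -> 0 <= e ->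
  (forall u, a <= u <= b -> g a - e <= g u) ->
  running_inf g a - e <= running_inf g b.
Proof.
move=> a0 ab e0 osc; apply: le_running_inf => [|u /andP[u0 ub]].
  exact: lt_le_trans ab.
have [ua|au] := leP u a.
  by apply: le_trans (running_inf_le (r := a) _); rewrite ?gerBl// u0.
apply: le_trans (osc u _); last by rewrite (ltW au).
by rewrite lerD2r running_inf_le// a0 lexx.
Qed.

Lemma running_inf_continuous :
  {in `]0, +oo[, continuous g} -> {in `]0, +oo[, continuous (running_inf g)}.
Proof.
move=> gc t t_pos; have t0 : 0 < t by move: t_pos; rewrite in_itv/= andbT.
apply/cvgrPdist_le => e e0.
have e20 : 0 < e / 2 by rewrite divr_gt0.
have /cvgrPdist_le/(_ _ e20)[d /= d0 g_near] := gc t t_pos.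
have running_near a b : 0 < a -> a <= b -> `|t - a| < d -> `|t - b| < d ->
    `|running_inf g a - running_inf g b| <= e.
  move=> a0 ab da db.
  have le_ab : running_inf g b <= running_inf g a.
    by apply: running_inf_noninc; rewrite ?in_itv/= ?andbT// (lt_le_trans a0).
  rewrite ger0_norm ?subr_ge0//.
  rewrite lerBlDr -lerBlDl; apply: running_inf_modulus => //; first exact: ltW.
  move=> u /andP[au ub]; have du : `|t - u| < d.
    move: da db; rewrite !ltr_norml => /andP[? ?] /andP[? ?].
    by apply/andP; lra.
  have := g_near u du; have := g_near a da.
  by rewrite /= !ler_norml => /andP[? _] /andP[_ ?]; lra.
near=> s.
have s0 : 0 < s by near: s; exact: lt_nbhsr.
have ds : `|t - s| < d by near: s; exists d.
have [ts|st] := leP t s; first by apply: running_near; rewrite ?subrr ?normr0.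
by rewrite distrC; apply: running_near; rewrite ?subrr ?normr0// ltW.
Unshelve. all: by end_near. Qed.

End running_inf.

Section classK.
Variable R : realType.
Implicit Types (rbar : \bar R) (phi psi w W : R -> R).

Lemma classK_is_derive rbar phi (t : R) : classK rbar phi ->
  0 < t -> (t%:E < rbar)%E -> is_derive t 1 phi (derive1 phi t).
Proof.
move=> [_ _ dphi] t0 tr; have [dt _ _] := dphi t t0 tr.
by rewrite derive1E; exact: DeriveDef.
Qed.

Lemma classK_derive1_gt0 rbar phi (t : R) : classK rbar phi ->
  0 < t -> (t%:E < rbar)%E -> 0 < derive1 phi t.
Proof. by move=> [_ _ dphi] t0 tr; have [] := dphi t t0 tr. Qed.

Lemma classK_restrict rbar rbar' phi : (rbar <= rbar')%E ->
  classK rbar' phi -> classK rbar phi.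
Proof.
move=> rr' [cphi phi0 dphi]; split=> //.
  apply: continuous_subspaceW cphi => t /= [t0 tr].
  by split=> //; exact: lt_le_trans rr'.
by move=> t t0 tr; apply: dphi => //; exact: lt_le_trans rr'.
Qed.

Lemma classK_le rbar phi (a b : R) : classK rbar phi ->
  0 <= a -> a <= b -> (b%:E < rbar)%E -> phi a <= phi b.
Proof.
move=> K a0 ab br; have [cphi _ _] := K.
have lt_rbar (t : R) : t <= b -> (t%:E < rbar)%E.
  by move=> tb; apply: le_lt_trans br; rewrite lee_fin.
move: ab; rewrite le_eqVlt => /predU1P[-> //|ab].
have [t||c] := @MVT R phi (derive1 phi) a b ab.
- rewrite in_itv/= => /andP[at_ /ltW tb].
  by apply: (classK_is_derive K (le_lt_trans a0 at_)); exact: lt_rbar.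
- apply: continuous_subspaceW cphi => t /=; rewrite in_itv/= => /andP[at_ tb].
  by split; [exact: le_trans at_|exact: lt_rbar].
rewrite in_itv/= => /andP[ac /ltW cb] phiE.
rewrite -subr_ge0 phiE mulr_ge0 ?subr_ge0 ?(ltW ab)// ltW//.
exact: (classK_derive1_gt0 K (le_lt_trans a0 ac) (lt_rbar c cb)).
Qed.

Lemma primitive_has_lbound W w phi dphi (r : R) : 0 < r ->
  {in `]0, +oo[, forall t : R, is_derive t 1 W (w t)} ->
  {in `]0, +oo[, forall t, 0 <= w t} ->
  {in `]0, r], forall t : R, is_derive t 1 phi (dphi t)} ->
  {in `]0, r], forall t, w t <= dphi t} ->
  {in `]0, r], forall t, 0 <= phi t} ->
  has_lbound [set W t | t in `]0, +oo[].
Proof.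
move=> r0 dW w0 dphiE w_le phi0; exists (W r - phi r) => _ [t /= t_pos <-].
have pos s : s \in `]0, r] -> s \in `]0, +oo[.
  by rewrite !in_itv/= andbT => /andP[].
have r_mem : r \in `]0, r] by rewrite in_itv/= r0 lexx.
have [rt|tr] := leP r t.
  have := is_derive1_ge0_homo dW w0 (pos r r_mem) t_pos rt.
  by have := phi0 r r_mem; lra.
have t_mem : t \in `]0, r].
  by move: t_pos; rewrite !in_itv/= andbT => ->; exact: ltW.
have : (phi - W) t <= (phi - W) r.
  apply: (@is_derive1_ge0_homo _ _ (fun s => dphi s - w s) `]0, r]) => //.
  - move=> s sr; apply: is_deriveB; [exact: dphiE|exact/dW/pos].
  - by move=> s sr; rewrite subr_ge0 w_le.
  - exact: ltW.
by rewrite !fctE; have := phi0 t t_mem; lra.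
Qed.

Lemma classKy_of_is_derive psi w :
  {in `]0, +oo[, forall t : R, is_derive t 1 psi (w t)} ->
  {in `]0, +oo[, continuous w} -> {in `]0, +oo[, forall t, 0 < w t} ->
  psi 0 = 0 -> {within `[0, +oo[, continuous psi} -> classK +oo%E psi.
Proof.
move=> dpsi cw w0 psi0 cpsi; split=> //.
  apply: continuous_subspaceW cpsi => t /= [t0 _].
  by rewrite in_itv/= t0.
have derive1_psi t : t \in `]0, +oo[ -> derive1 psi t = w t.
  by move=> t_pos; rewrite derive1E; have [] := dpsi t t_pos.
move=> t t0 _; have t_pos : t \in `]0, +oo[ by rewrite in_itv/= t0.
rewrite derive1_psi ?w0//; split=> //; first by have [] := dpsi t t_pos.
rewrite /prop_for /continuous_at derive1_psi//; apply: cvg_trans (cw t t_pos).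
apply: near_eq_cvg; near=> s; rewrite derive1_psi// in_itv/= andbT.
by near: s; exact: lt_nbhsr.
Unshelve. all: by end_near. Qed.

Lemma classK_concave_primitive W w :
  {in `]0, +oo[, forall t : R, is_derive t 1 W (w t)} ->
  {in `]0, +oo[, continuous w} -> {in `]0, +oo[, forall t, 0 < w t} ->
  {in `]0, +oo[ &, {homo w : a b /~ a <= b}} ->
  has_lbound [set W t | t in `]0, +oo[] ->
  exists psi, [/\ classK +oo%E psi, concave_on_nonneg psi &
    {in `]0, +oo[, derive1 psi =1 w}].
Proof.
move=> dW cw w0 w_noninc W_lb; set m := inf [set W t | t in `]0, +oo[].
have W_homo : {in `]0, +oo[ &, {homo W : a b / a <= b}}.
  by apply: is_derive1_ge0_homo dW _ => t /w0/ltW.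
pose psi t := if 0 < t then W t - m else 0.
have dpsi : {in `]0, +oo[, forall t : R, is_derive t 1 psi (w t)}.
  move=> t t_pos; apply: (@near_eq_is_derive _ _ _ (W - cst m)).
    near=> s; rewrite /psi ifT//; near: s; apply: lt_nbhsr.
    by move: t_pos; rewrite in_itv/= andbT.
  by rewrite -[X in is_derive _ _ _ X]subr0; apply: is_deriveB; exact: dW.
have psi0 : psi 0 = 0 by rewrite /psi ltxx.
have cpsi : {within `[0, +oo[, continuous psi}.
  apply/continuous_within_itvcyP; split=> [t /dpsi/is_derive1_continuous //|].
  rewrite psi0 -[X in _ --> X](subrr m).
  apply: (@cvg_trans _ ((W s - m) @[s --> 0^'+])).
    by apply: near_eq_cvg; near=> s; rewrite /psi ifT.
  by apply: cvgB; [exact: nondecreasing_at_right_cvgr|exact: cvg_cst].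
exists psi; split; first exact: classKy_of_is_derive dpsi cw w0 psi0 cpsi.
  exact: derive_noninc_concave cpsi dpsi w_noninc.
by move=> t t_pos; rewrite derive1E; have [] := dpsi t t_pos.
Unshelve. all: by end_near. Qed.

Lemma classK_concave_primitive_dominated w phi dphi (r : R) : 0 < r ->
  {in `]0, +oo[, continuous w} -> {in `]0, +oo[, forall t, 0 < w t} ->
  {in `]0, +oo[ &, {homo w : a b /~ a <= b}} ->
  {in `]0, r], forall t : R, is_derive t 1 phi (dphi t)} ->
  {in `]0, r], forall t, w t <= dphi t} ->
  {in `]0, r], forall t, 0 <= phi t} ->
  exists psi, [/\ classK +oo%E psi, concave_on_nonneg psi &
    {in `]0, +oo[, derive1 psi =1 w}].
Proof.
move=> r0 cw w0 w_noninc dphiE w_le phi0.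
have dW : {in `]0, +oo[, forall t : R,
    is_derive t 1 (oriented_Rintegral w 1) (w t)}.
  move=> t; rewrite in_itv/= andbT => t0.
  apply: (@is_derive_oriented_Rintegral _ _ 0 (t + 2)).
  - move=> s; rewrite in_itv/= => /andP[s0 _].
    by apply: cw; rewrite in_itv/= s0.
  - by rewrite in_itv/= ltr01; lra.
  - by rewrite in_itv/= t0; lra.
apply: (classK_concave_primitive dW) => //.
apply: (primitive_has_lbound r0 dW _ dphiE) => //.
by move=> t /w0/ltW.
Qed.

Lemma classK_concave_ge_running_inf rbar phi (r : R) :
  classK rbar phi -> 0 < r -> (r%:E < rbar)%E ->
  exists psi, [/\ classK +oo%E psi, concave_on_nonneg psi &
    {in `]0, +oo[, forall t,
      running_inf (fun s => derive1 phi (Num.min s r)) t <= derive1 psi t}].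
Proof.
move=> K r0 r_lt; pose g s := derive1 phi (Num.min s r).
have le_r_lt t : t <= r -> (t%:E < rbar)%E.
  by move=> tr; apply: le_lt_trans r_lt; rewrite lee_fin.
have min_itv s : 0 < s -> 0 < Num.min s r /\ ((Num.min s r)%:E < rbar)%E.
  by move=> s0; rewrite lt_min s0 le_r_lt// ge_min lexx orbT.
have g0 s : 0 < s -> 0 <= g s.
  by move=> /min_itv[s0 sr]; exact/ltW/(classK_derive1_gt0 K).
have cg : {in `]0, +oo[, continuous g}.
  move=> s; rewrite in_itv/= andbT => /min_itv[s0 sr].
  apply: (@continuous_comp _ _ _ (fun s : R => Num.min s r)).
    by apply: continuous_min; [exact: cvg_id|exact: cvg_cst].
  by have [_ _ /(_ _ s0 sr)[]] := K.
have [||||||psi [Kpsi cpsi dpsi]] := @classK_concave_primitive_dominated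
    (fun t => running_inf g t + 1) (phi + id) (derive1 phi + cst 1) r r0.
- move=> t t_pos; apply: cvgD; last exact: cvg_cst.
  exact: (running_inf_continuous g0).
- move=> t; rewrite in_itv/= andbT => t0; rewrite ltr_wpDl// le_running_inf//.
  by move=> s /andP[/g0].
- by move=> a b a0 b0 ab; rewrite lerD2r (running_inf_noninc g0).
- move=> t; rewrite in_itv/= => /andP[t0 tr].
  by apply: is_deriveD; apply: (classK_is_derive K) => //; exact: le_r_lt.
- move=> t; rewrite in_itv/= => /andP[t0 tr]; rewrite !fctE lerD2r.
  rewrite (le_trans (running_inf_le g0 (r := t) (s := t) _)) ?t0 ?lexx//.
  by rewrite /g min_l.
- move=> t; rewrite in_itv/= => /andP[t0 tr]; have [_ phi0 _] := K.
  rewrite !fctE addr_ge0 ?(ltW t0)// -phi0 (classK_le K) ?(ltW t0)//.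
  exact: le_r_lt.
by exists psi; split=> // t t_pos; rewrite dpsi// lerDl.
Qed.

Lemma classK_concave_desingularization phi (r0 : R) :
  classK r0%:E phi -> 0 < r0 ->
  exists psi, [/\ classK +oo%E psi, concave_on_nonneg psi &
    forall t k, 0 < t -> 0 <= k ->
      (forall s, 0 < s < r0 -> s <= t -> 1 <= derive1 phi s * k) ->
      1 <= derive1 psi t * k].
Proof.
move=> K r0_gt0; have [r_gt0 r_lt] : 0 < r0 / 2 /\ r0 / 2 < r0 by split; lra.
have [psi [Kpsi cpsi psi_ge]] := classK_concave_ge_running_inf K r_gt0 r_lt.
exists psi; split=> // t k t0 k0 phi_k.
have min_k s : 0 < s -> s <= t -> 1 <= derive1 phi (Num.min s (r0 / 2)) * k.
  move=> s0 st; apply: phi_k; last by rewrite ge_min st.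
  by rewrite lt_min gt_min s0 r_gt0 r_lt orbT.
have k_gt0 : 0 < k.
  rewrite lt_neqAle k0 andbT; apply/eqP => k_eq0.
  by have := min_k t t0 (lexx t); rewrite -k_eq0 mulr0 ler10.
rewrite -ler_pdivrMr//; apply: le_trans (psi_ge t _); last first.
  by rewrite in_itv/= t0.
by apply: le_running_inf => // s /andP[s0 st]; rewrite ler_pdivrMr// min_k.
Qed.

End classK.

Lemma convex_setP (R : numDomainType) (V : lmodType R)
    (C : set (convex_lmodType V)) :
  convex_set C <-> forall (x y : V) (t : R), 0 <= t <= 1 -> C x -> C y ->
    C (t *: x + (1 - t) *: y).
Proof.
split=> [Ccv x y t /andP[t0 t1] Cx Cy|Ccv x y t /set_mem Cx /set_mem Cy].
  by have /set_mem := Ccv x y (Itv01 t0 t1) (mem_set Cx) (mem_set Cy).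
by apply/mem_set/Ccv => //; rewrite ge0 le1.
Qed.

Section inner_product.
Context {R : realType} {V : completeNormedModType R}.
Variable inner : V -> V -> R.
Hypothesis ip : is_inner_product inner.

Lemma innerC x y : inner x y = inner y x.
Proof. by have [h _ _ _] := ip. Qed.

Lemma innerDl x y z : inner (x + y) z = inner x z + inner y z.
Proof. by have [_ h _ _] := ip; have := h 1 x y z; rewrite scale1r mul1r. Qed.

Lemma inner0l z : inner 0 z = 0.
Proof. by have := innerDl 0 0 z; rewrite addr0; lra. Qed.

Lemma innerZl a x z : inner (a *: x) z = a * inner x z.
Proof.
by have [_ h _ _] := ip; have := h a x 0 z; rewrite !addr0 inner0l addr0.
Qed.

Lemma innerNl x z : inner (- x) z = - inner x z.
Proof. by rewrite -scaleN1r innerZl mulN1r. Qed.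

Lemma innerBl x y z : inner (x - y) z = inner x z - inner y z.
Proof. by rewrite innerDl innerNl. Qed.

Lemma innerZr a x z : inner z (a *: x) = a * inner z x.
Proof. by rewrite innerC innerZl innerC. Qed.

Lemma innerNr x z : inner z (- x) = - inner z x.
Proof. by rewrite innerC innerNl innerC. Qed.

Lemma innerDr x y z : inner z (x + y) = inner z x + inner z y.
Proof. by rewrite innerC innerDl !(innerC z). Qed.

Lemma innerBr x y z : inner z (x - y) = inner z x - inner z y.
Proof. by rewrite innerDr innerNr. Qed.

Lemma innerxx (x : V) : inner x x = `|x| ^+ 2.
Proof. by have [_ _ h n] := ip; rewrite n sqr_sqrtr. Qed.

Lemma inner_le_norm (x y : V) : inner x y <= `|x| * `|y|.
Proof.
have [->|x0] := eqVneq x 0; first by rewrite inner0l normr0 mul0r.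
have [->|y0] := eqVneq y 0; first by rewrite innerC inner0l normr0 mulr0.
have nxy : 0 < `|x| * `|y| by rewrite mulr_gt0 ?normr_gt0.
have : 0 <= inner (`|y| *: x - `|x| *: y) (`|y| *: x - `|x| *: y).
  by rewrite innerxx sqr_ge0.
rewrite !(innerBl, innerBr, innerZl, innerZr) !innerxx (innerC y x) => sq_ge0.
have : 0 <= (`|x| * `|y|) * (2 * (`|x| * `|y| - inner x y)) by nra.
by rewrite pmulr_rge0// pmulr_rge0// subr_ge0.
Qed.

Lemma normr_inner_le (x y : V) : `|inner x y| <= `|x| * `|y|.
Proof.
by rewrite ler_norml inner_le_norm lerNl -innerNr -(normrN y) inner_le_norm.
Qed.

Lemma inner_continuous (x : V) : continuous (inner x).
Proof.
move=> y; apply/cvgrPdist_lt => e e0.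
have x1 : 0 < `|x| + 1 by rewrite ltr_wpDl.
near=> z; rewrite -innerBr; apply: le_lt_trans (normr_inner_le _ _) _.
apply: (@le_lt_trans _ _ ((`|x| + 1) * `|y - z|)).
  by rewrite ler_wpM2r// lerDl.
rewrite mulrC -ltr_pdivlMr//; near: z.
by apply: (@cvgr_dist_lt _ _ _ _ _ id) => //; exact: divr_gt0.
Unshelve. all: by end_near. Qed.

Lemma inner_sub_cvg0 (x y : V) : inner x (z - y) @[z --> y] --> 0.
Proof.
rewrite -(inner0l x) innerC -[X in inner x X](subrr y).
apply: (@cvg_comp _ _ _ (fun z => z - y)); last exact: inner_continuous.
by apply: cvgB; [exact: cvg_id|exact: cvg_cst].
Qed.

Lemma parallelogram (x y : V) :
  `|x - y| ^+ 2 + `|x + y| ^+ 2 = 2 * `|x| ^+ 2 + 2 * `|y| ^+ 2.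
Proof.
rewrite -!innerxx !(innerDl, innerDr, innerNl, innerNr) (innerC y x); ring.
Qed.

Definition inf_sqdist (C : set V) (x : V) : R :=
  inf [set `|x - z| ^+ 2 | z in C].

Definition nearly_nearest (C : set V) (x : V) (e : R) : set V :=
  [set z | C z /\ `|x - z| ^+ 2 <= inf_sqdist C x + e].

Lemma inf_sqdist_le (C : set V) (x z : V) :
  C z -> inf_sqdist C x <= `|x - z| ^+ 2.
Proof.
move=> Cz; apply: ge_inf; last by exists z.
by exists 0 => _ [u _ <-]; exact: sqr_ge0.
Qed.

Lemma nearly_nearest_neq0 (C : set V) (x : V) (e : R) :
  C !=set0 -> 0 < e -> nearly_nearest C x e !=set0.
Proof.
move=> [z0 Cz0] e0; pose D := [set `|x - z| ^+ 2 | z in C].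
have D_inf : has_inf D.
  split; first by exists (`|x - z0| ^+ 2), z0.
  by exists 0 => _ [u _ <-]; exact: sqr_ge0.
by have [_ [z Cz <-] /ltW] := inf_adherent e0 D_inf; exists z.
Qed.

Lemma nearly_nearest_close (C : set V) (x z z' : V) (e : R) : convex_set C ->
  nearly_nearest C x e z -> nearly_nearest C x e z' ->
  `|z - z'| ^+ 2 <= 4 * e.
Proof.
move=> /convex_setP Ccv [Cz zm] [Cz' z'm].
pose w := 2^-1 *: z + (1 - 2^-1) *: z'.
have wm : inf_sqdist C x <= `|x - w| ^+ 2.
  by apply/inf_sqdist_le/Ccv => //; apply/andP; split; lra.
have := parallelogram (x - z') (x - z).
have -> : (x - z') - (x - z) = z - z' by rewrite opprB addrC subrKA.
have -> : (x - z') + (x - z) = 2 *: (x - w).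
  rewrite scalerBr /w scalerDr !scalerA mulrBr mulr1 mulfV//.
  have -> : 2 - 1 = 1 :> R by ring.
  by rewrite !scale1r scaler_nat mulr2n opprD addrACA [- z + _]addrC addrACA.
by rewrite normrZ exprMn ger0_norm//; lra.
Qed.

Lemma nearest_point (C : set V) (x : V) :
  closed C -> convex_set C -> C !=set0 ->
  exists2 y, C y & forall z, C z -> `|x - y| <= `|x - z|.
Proof.
move=> Ccl Ccv C0.
pose F := filter_from [set e : R | 0 < e] (nearly_nearest C x).
have FF : ProperFilter F.
  apply: filter_from_proper => [|e /=]; last exact: nearly_nearest_neq0.
  apply: filter_from_filter; first by exists 1 => /=.
  move=> a b /= a0 b0; exists (Num.min a b); first by rewrite /= lt_min a0.
  by move=> z [Cz]; rewrite -lerBlDl le_min !lerBlDl => /andP[? ?]; do 2 split.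
have near_F e : 0 < e -> \forall z \near F, nearly_nearest C x e z.
  by move=> e0; exists e.
have cvgF : cvg F.
  apply/cauchy_cvgP/cauchy_exP => e e0; have e20 := exprn_gt0 2 e0.
  have e80 : 0 < e ^+ 2 / 8 by rewrite divr_gt0.
  have [z zm] := filter_ex (near_F _ e80).
  exists z, (e ^+ 2 / 8) => // z' z'm; rewrite -ball_normE /=.
  rewrite -(@ltr_pXn2r _ 2) ?nnegrE ?(ltW e0)//.
  by have := nearly_nearest_close Ccv zm z'm; lra.
have sqdist_cvg : `|x - z| ^+ 2 @[z --> F] --> `|x - lim F| ^+ 2.
  have dist_cvg : `|x - z| @[z --> F] --> `|x - lim F|.
    by apply: cvg_norm; apply: cvgB; [exact: cvg_cst|exact: cvgF].
  exact: cvgM.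
exists (lim F).
  apply: (@closed_cvg _ _ F _ id C Ccl) cvgF.
  by apply: filterS (near_F 1 ltr01) => z [].
move=> z Cz; rewrite -(@ler_pXn2r _ 2) ?nnegrE//.
apply: le_trans (inf_sqdist_le x Cz); apply/ler_addgt0Pr => e e0.
by apply: cvgr_to_le sqdist_cvg _; apply: filterS (near_F e e0) => u [].
Qed.

Lemma projection (C : set V) (x : V) :
  closed C -> convex_set C -> C !=set0 ->
  exists2 y, C y & forall z, C z -> inner (x - y) (z - y) <= 0.
Proof.
move=> Ccl Ccv C0; have [y Cy ymin] := nearest_point x Ccl Ccv C0.
exists y => // z Cz.
suff le_t t : 0 < t <= 1 ->
    2 * inner (x - y) (z - y) <= 0 + t * `|z - y| ^+ 2.
  by have := ler_add_small_mul le_t; rewrite pmulr_rle0.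
move=> /andP[t0 t1]; have t01 : 0 <= t <= 1 by rewrite ltW.
have := ymin _ ((convex_setP C).1 Ccv z y t t01 Cz Cy).
have -> : x - (t *: z + (1 - t) *: y) = (x - y) - t *: (z - y).
  rewrite scalerBl scale1r scalerBr !opprD !opprK -!addrA.
  by congr (_ + _); rewrite addrCA.
rewrite -(@ler_pXn2r _ 2)// ?nnegrE// -!innerxx.
rewrite !(innerBl (x - y), innerBr (x - y), innerBr _ (t *: _)).
rewrite !(innerZl, innerZr).
rewrite (innerC (z - y)) (innerxx (z - y)) => dist_le.
by rewrite -(ler_pM2l t0); lra.
Qed.

End inner_product.

Section convex_functions.
Context {R : realType} {V : completeNormedModType R}.
Variable f : V -> \bar R.
Hypothesis f_cvx : convex_efun f.

Lemma convex_efun_le (x y : V) (a b t : R) : 0 <= t <= 1 ->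
  (f x <= a%:E)%E -> (f y <= b%:E)%E ->
  (f (t *: x + (1 - t) *: y)%R <= (t * a + (1 - t) * b)%:E)%E.
Proof.
move=> t01 fxa fyb; have /andP[t0 t1] := t01.
have f_le := f_cvx t01 (le_lt_trans fxa (ltry a)) (le_lt_trans fyb (ltry b)).
apply: le_trans f_le _.
by rewrite [leRHS]EFinD !EFinM leeD// lee_wpmul2l// lee_fin ?subr_ge0.
Qed.

Lemma sublevel_convex (r : R) : convex_set [set z | (f z <= r%:E)%E].
Proof.
apply/convex_setP => x y t t01 /= fx fy; have := convex_efun_le t01 fx fy.
by rewrite -mulrDl subrKC mul1r.
Qed.

Section lagrange.
Variables (l : V -> R) (r : R) (x0 : V).
Hypothesis l_concave : forall x y t, 0 <= t <= 1 ->
  t * l x + (1 - t) * l y <= l (t *: x + (1 - t) *: y).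
Hypothesis fx0 : (f x0 < +oo)%E.
Hypothesis lx0 : 0 < l x0.

Let fx0_ub : exists a, (f x0 <= a%:E)%E.
Proof.
by case: (f x0) fx0 => [a _|//|_]; [exists a|exists 0; exact: leNye].
Qed.

Lemma sublevel_half_space :
  (forall z, (f z <= r%:E)%E -> l z <= 0) ->
  forall z, 0 <= l z -> (r%:E <= f z)%E.
Proof.
move=> sub_half z lz; apply: le_EFin_ub => c fzc; have [a fx0a] := fx0_ub.
suff r_le t : 0 < t <= 1 -> r <= c + t * (a - c).
  exact: ler_add_small_mul r_le.
move=> /andP[t0 t1]; have t01 : 0 <= t <= 1 by rewrite ltW.
have := convex_efun_le t01 fx0a fzc.
have -> : t * a + (1 - t) * c = c + t * (a - c) by ring.
rewrite -lee_fin; apply: le_trans; rewrite leNgt; apply/negP => /ltW/sub_half.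
rewrite leNgt (lt_le_trans _ (l_concave x0 z t01))// ltr_wpDr ?mulr_gt0//.
by rewrite mulr_ge0// subr_ge0.
Qed.

Hypothesis r_le : forall z, 0 <= l z -> (r%:E <= f z)%E.

Lemma slope_le_across_half_space (u z : V) (d c : R) :
  (f u <= d%:E)%E -> 0 < l u -> (f z <= c%:E)%E -> l z < 0 ->
  (r - c) / - l z <= (d - r) / l u.
Proof.
move=> fu lu fz lz.
rewrite ler_pdivrMr ?oppr_gt0// mulrAC ler_pdivlMr//.
have luz : 0 < l u - l z by lra.
pose t := - l z / (l u - l z).
have tE : t * (l u - l z) = - l z by rewrite divfK// gt_eqF.
have t01 : 0 <= t <= 1.
  by rewrite divr_ge0 ?ler_pdivrMr ?mul1r ?(ltW luz)//=; lra.
have l_ge0 : 0 <= l (t *: u + (1 - t) *: z).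
  apply: le_trans (l_concave u z t01).
  have -> : t * l u + (1 - t) * l z = l z + t * (l u - l z) by ring.
  by rewrite tE subrr.
have := le_trans (r_le l_ge0) (convex_efun_le t01 fu fz); rewrite lee_fin.
have -> : t * d + (1 - t) * c = c + t * (d - c) by ring.
by move=> /(ler_wpM2r (ltW luz)); rewrite mulrDl mulrAC tE; lra.
Qed.

Lemma lagrange_multiplier :
  exists2 lam, 0 <= lam & forall z, ((r + lam * l z)%:E <= f z)%E.
Proof.
have r_le_ub z c : 0 <= l z -> (f z <= c%:E)%E -> r <= c.
  by move=> lz fz; rewrite -lee_fin (le_trans _ fz)// r_le.
pose S := [set q | exists u d,
  [/\ (f u <= d%:E)%E, 0 < l u & q = (d - r) / l u]].
have S_ge0 q : S q -> 0 <= q.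
  by move=> [u [d [fu lu ->]]]; rewrite divr_ge0 ?subr_ge0 ?(r_le_ub u)// ltW.
have S0 : S !=set0 by have [a fa] := fx0_ub; exists ((a - r) / l x0), x0, a.
exists (inf S) => [|z]; first exact: lb_le_inf.
apply: le_EFin_ub => c fz; have [lz|lz|lz] := ltgtP (l z) 0.
- suff : (r - c) / - l z <= inf S by rewrite ler_pdivrMr ?oppr_gt0//; lra.
  apply: lb_le_inf => // _ [u [d [fu lu ->]]].
  exact: slope_le_across_half_space.
- rewrite -lerBrDl -ler_pdivlMr//; apply: ge_inf; first by exists 0.
  by exists z, c.
- by rewrite lz mulr0 addr0 (r_le_ub z)// lz.
Qed.

End lagrange.

End convex_functions.

Lemma lower_semicontinuous_sublevel_closed (R : realType) (T : topologicalType)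
    (f : T -> \bar R) (r : R) :
  lower_semicontinuous f -> closed [set z | (f z <= r%:E)%E].
Proof.
move=> /lower_semicontinuousP f_lsc.
rewrite (_ : [set z | _] = ~` [set z | (r%:E < f z)%E]).
  exact/open_closedC/f_lsc.
by apply/seteqP; split=> z /=; rewrite leNgt => /negP.
Qed.

Definition convex_subdiff {R : realType} {V : completeNormedModType R}
    (inner : V -> V -> R) (f : V -> \bar R) (x : V) : set V :=
  [set p | f x \is a fin_num /\
    forall z, (f x + (inner p (z - x)%R)%:E <= f z)%E].

Section frechet_subdifferential.
Context {R : realType} {V : completeNormedModType R}.
Variable inner : V -> V -> R.
Hypothesis ip : is_inner_product inner.

Lemma frechet_subdiffP (g : V -> \bar R) (x p : V) (a : R) : g x = a%:E ->
  frechet_subdiff inner g x p <-> forall e : R, 0 < e -> \forall y \near x,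
    ((a + inner p (y - x) - e * `|y - x|)%:E <= g y)%E.
Proof.
move=> gx; have quotientP e y : y != x ->
    ((0 - e)%:E <=
      (g y - g x - (inner p (y - x)%R)%:E) * (`|(y - x)%R|^-1)%:E)%E <->
    ((a + inner p (y - x) - e * `|y - x|)%:E <= g y)%E.
  move=> yx; have n0 : 0 < `|y - x| by rewrite normr_gt0 subr_eq0.
  rewrite gx; case: (g y) => [b| |] /=.
  - by rewrite !lee_fin ler_pdivlMr// sub0r mulNr; split; lra.
  - by rewrite gt0_mulye ?lte_fin ?invr_gt0// !leey.
  - by rewrite gt0_mulNye ?lte_fin ?invr_gt0// !leeNy_eq.
rewrite /frechet_subdiff /= gx; split=> [[_ /limf_einf_geP le_g]|le_g].
  move=> e e0; have := le_g e e0; rewrite nearE /= /dnbhs /within /=.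
  apply: filterS => y le_gy; have [->|yx] := eqVneq y x.
    by rewrite gx subrr (innerC ip) (inner0l ip) normr0 mulr0 subr0 addr0.
  by rewrite -quotientP// gx; exact: le_gy.
split=> //; apply/limf_einf_geP => e e0; rewrite /dnbhs near_withinE.
by apply: filterS (le_g e e0) => y le_gy yx; rewrite -gx quotientP.
Qed.

Lemma frechet_subdiff_le_derive (g : V -> \bar R) (x p v : V) (h : R -> R)
    (d : R) :
  frechet_subdiff inner g x p -> g x = (h 0)%:E -> is_derive (0 : R) 1 h d ->
  (\forall t \near 0^'+, (g (x + t *: v)%R <= (h t)%:E)%E) -> inner p v <= d.
Proof.
move=> p_sub gx [dh <-] g_le_h; have /(frechet_subdiffP p gx) le_g := p_sub.
suff le_d e : 0 < e <= 1 -> inner p v <= 'D_1 h 0 + e * `|v|.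
  exact: ler_add_small_mul le_d.
move=> /andP[e0 _]; rewrite -lerBlDr.
apply: cvgr_to_ge (cvg_dnbhs_at_right dh) _ => /=.
have x_cvg : x + t *: v @[t --> 0^'+] --> x.
  rewrite -[X in _ --> X]addr0 -(scale0r v); apply: cvgD; first exact: cvg_cst.
  by apply: cvgZl; exact: cvg_at_right_filter cvg_id.
have le_g_line := x_cvg _ (le_g e e0).
near=> t; have t0 : 0 < t by [].
have le_gt : ((h 0 + inner p (x + t *: v - x) - e * `|x + t *: v - x|)%:E
    <= g (x + t *: v)%R)%E by near: t; exact: le_g_line.
have gt_le : (g (x + t *: v)%R <= (h t)%:E)%E by near: t.
move: (le_trans le_gt gt_le).
rewrite [x + _]addrC addrK lee_fin (innerZr ip) normrZ gtr0_norm//.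
rewrite addr0 [t *: 1]mulr1 [_ *: _]mulrC ler_pdivlMr//; lra.
Unshelve. all: by end_near. Qed.

Lemma frechet_subdiff_of_minorant (g : V -> \bar R) (x q : V) (h : R -> R)
    (d : R) :
  g x = (h 0)%:E -> is_derive (0 : R) 1 h d ->
  (\forall y \near x, ((h (inner q (y - x)))%:E <= g y)%E) ->
  frechet_subdiff inner g x (d *: q).
Proof.
move=> gx dh h_le_g; apply/(frechet_subdiffP _ gx) => e e0.
have q1 : 0 < `|q| + 1 by rewrite ltr_wpDl.
have := is_derive1_ge_expansion dh (divr_gt0 e0 q1).
move=> /(inner_sub_cvg0 ip q x).
apply: filterS2 h_le_g => y h_le_gy /= expansion.
apply: le_trans h_le_gy; rewrite lee_fin; rewrite add0r in expansion.
apply: le_trans expansion.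
rewrite (innerZl ip) lerD2l lerN2 mulrAC ler_pdivrMr//.
rewrite -mulrA ler_pM2l//; apply: le_trans (normr_inner_le ip _ _) _.
by rewrite mulrC ler_wpM2l// lerDl.
Qed.

End frechet_subdifferential.

Section compK_monotone.
Context {R : realType} {V : completeNormedModType R}.
Variables (f : V -> \bar R) (rbar : \bar R) (phi : R -> R) (z : V).
Hypothesis fz_ge0 : (0 <= f z)%E.
Hypothesis K : classK rbar phi.

Lemma compK_EFin (a : R) : f z = a%:E -> (a%:E < rbar)%E ->
  compK rbar phi f z = (phi a)%:E.
Proof.
by move=> fz a_lt; move: fz_ge0; rewrite /compK fz => ->; rewrite a_lt.
Qed.

Lemma compK_le (c : R) : (f z <= c%:E)%E -> (c%:E < rbar)%E ->
  (compK rbar phi f z <= (phi c)%:E)%E.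
Proof.
move=> fzc c_lt; rewrite /compK fz_ge0 (le_lt_trans fzc c_lt) /= lee_fin.
case: (f z) fz_ge0 fzc => //= b; rewrite !lee_fin => b0 bc.
exact: classK_le K b0 bc c_lt.
Qed.

Lemma compK_ge (c : R) : 0 <= c -> (c%:E <= f z)%E ->
  ((phi c)%:E <= compK rbar phi f z)%E.
Proof.
move=> c0 c_le; rewrite /compK fz_ge0 /=; case: ifPn => [|_]; last exact: leey.
case: (f z) c_le => [b| |//] /=; last by move=> _; rewrite ltNge leey.
by rewrite !lee_fin => cb b_lt; exact: classK_le K c0 cb b_lt.
Qed.

End compK_monotone.

Section chain_rule.
Context {R : realType} {V : completeNormedModType R}.
Variables (inner : V -> V -> R) (f : V -> \bar R).
Variables (rbar : \bar R) (phi : R -> R) (x : V) (a : R).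
Hypothesis ip : is_inner_product inner.
Hypothesis f_ge0 : forall z, (0 <= f z)%E.
Hypothesis f_cvx : convex_efun f.
Hypothesis K : classK rbar phi.
Hypothesis fx : f x = a%:E.
Hypothesis a_gt0 : 0 < a.
Hypothesis a_lt : (a%:E < rbar)%E.

Let compKx : compK rbar phi f x = (phi a)%:E.
Proof. exact: compK_EFin. Qed.

(* [f] may be discontinuous at [x]: since [phi] is monotone, the affine
   minorant of [f] at [x] can stand for [f] in the difference quotient. *)
Lemma frechet_subdiff_compK_of_convex (q : V) : convex_subdiff inner f x q ->
  frechet_subdiff inner (compK rbar phi f) x (derive1 phi a *: q).
Proof.
move=> [_ f_ge]; apply: (frechet_subdiff_of_minorant ip (h := phi \o +%R a)).
- by rewrite compKx /= addr0.
- rewrite -[derive1 phi a]mulr1; apply: is_derive1_comp.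
    by rewrite addr0; exact: classK_is_derive K a_gt0 a_lt.
  by rewrite -[X in is_derive _ _ _ X]add0r; apply: is_deriveD.
have inner_cvg : a + inner q (y - x) @[y --> x] --> a.
  rewrite -[X in _ --> X]addr0; apply: cvgD; first exact: cvg_cst.
  exact: inner_sub_cvg0.
near=> y; apply: compK_ge => //; last by have := f_ge y; rewrite fx.
by apply: ltW; near: y; exact: cvgr_gt inner_cvg _ a_gt0.
Unshelve. all: by end_near. Qed.

Lemma convex_subdiff_of_compK (p : V) :
  frechet_subdiff inner (compK rbar phi f) x p ->
  convex_subdiff inner f x ((derive1 phi a)^-1 *: p).
Proof.
move=> p_sub; have d0 := classK_derive1_gt0 K a_gt0 a_lt.
split=> [|z]; rewrite fx// -EFinD; apply: le_EFin_ub => c fzc.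
rewrite (innerZl ip) -lerBrDl mulrC ler_pdivrMr// mulrC.
pose line t := a + t * (c - a).
have line0 : line 0 = a by rewrite /line mul0r addr0.
apply: (frechet_subdiff_le_derive ip (h := phi \o line) p_sub).
- by rewrite compKx /= line0.
- apply: is_derive1_comp.
    by rewrite line0; exact: classK_is_derive K a_gt0 a_lt.
  rewrite -[X in is_derive _ _ _ X]add0r; apply: is_deriveD.
  by apply: is_derive_eq; rewrite /GRing.scale /= mulr1 mulr0 add0r.
have line_lt : \forall t \near 0^'+, ((line t)%:E < rbar)%E.
  have line_cvg : line t @[t --> 0^'+] --> a.
    rewrite -[X in _ --> X]line0; apply: cvgD; first exact: cvg_cst.
    by apply: cvgMl; exact: cvg_at_right_filter cvg_id.
  exact: line_cvg _ (open_nbhs_nbhs (conj (@open_ereal_lt _ rbar) a_lt)).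
near=> t; have t0 : 0 < t by [].
have t01 : 0 <= t <= 1 by rewrite ltW//; near: t; exact: nbhs_right_le.
have f_line : (f (x + t *: (z - x))%R <= (line t)%:E)%E.
  have fxa : (f x <= a%:E)%E by rewrite fx.
  have := convex_efun_le f_cvx t01 fzc fxa.
  have -> : t * c + (1 - t) * a = line t by rewrite /line; ring.
  by rewrite scalerBl scale1r addrCA -scalerBr.
by apply: compK_le => //; near: t.
Unshelve. all: by end_near. Qed.

Lemma frechet_subdiff_compK :
  frechet_subdiff inner (compK rbar phi f) x =
  [set derive1 phi a *: q | q in convex_subdiff inner f x].
Proof.
apply/seteqP; split=> [p p_sub|_ [q q_sub <-]]; last first.
  exact: frechet_subdiff_compK_of_convex.
exists ((derive1 phi a)^-1 *: p); first exact: convex_subdiff_of_compK.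
by rewrite scalerA mulfV ?scale1r// gt_eqF// (classK_derive1_gt0 K).
Qed.

End chain_rule.

Lemma inf_norm_ge1P (R : realType) (V : completeNormedModType R) (C : set V) :
  (1 <= inf_norm C)%E <-> forall p, C p -> 1 <= `|p|.
Proof.
split=> [/ereal_infP C_ge1 p Cp|C_ge1].
  by rewrite -lee_fin; apply: C_ge1; exists p.
by apply/ereal_infP => _ [p Cp <-]; rewrite lee_fin C_ge1.
Qed.

Lemma sublevel_neq0 (R : realType) (T : Type) (f : T -> \bar R) (r : R) :
  (ereal_inf (range f) < r%:E)%E -> [set z | (f z <= r%:E)%E] !=set0.
Proof. by move=> /ereal_inf_lt[_ [z _ <-] /ltW]; exists z. Qed.

Section level_sets.
Context {R : realType} {V : completeNormedModType R}.
Variables (inner : V -> V -> R) (f : V -> \bar R).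
Hypothesis ip : is_inner_product inner.
Hypothesis f_cvx : convex_efun f.

Lemma inf_norm_frechet_subdiff_compK_ge1P (rbar : \bar R) (phi : R -> R)
    (x : V) : (forall z, (0 <= f z)%E) -> classK rbar phi -> (0 < f x)%E ->
  (1 <= inf_norm (frechet_subdiff inner (compK rbar phi f) x))%E <->
  forall a q, f x = a%:E -> (a%:E < rbar)%E -> convex_subdiff inner f x q ->
    1 <= derive1 phi a * `|q|.
Proof.
move=> f_ge0 K fx0; rewrite inf_norm_ge1P.
split=> [sub_ge1 a q fx ar q_sub|ge1 p].
  have a0 : 0 < a by rewrite -lte_fin -fx.
  rewrite -(gtr0_norm (classK_derive1_gt0 K a0 ar)) -normrZ; apply: sub_ge1.
  by rewrite (frechet_subdiff_compK ip f_ge0 f_cvx K fx a0 ar); exists q.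
move=> p_sub; have [cfin _] := p_sub.
have [a fx ar] : exists2 a, f x = a%:E & (a%:E < rbar)%E.
  move: cfin fx0; rewrite /compK; case: ifP => // /andP[_].
  by case: (f x) => [a ar _ _| |//]; [exists a|rewrite ltNge leey].
have a0 : 0 < a by rewrite -lte_fin -fx.
move: p_sub; rewrite (frechet_subdiff_compK ip f_ge0 f_cvx K fx a0 ar).
move=> [q q_sub <-]; rewrite normrZ gtr0_norm ?ge1//.
exact: classK_derive1_gt0 K a0 ar.
Qed.

(* With [y] the projection of [x] onto [f <= s], the subgradient at [y] is
   [lam *: (x - y)], where [lam] is the Lagrange multiplier of minimizing [f]
   over the half-space [<x - y, z - y> >= 0]. *)
Lemma convex_subdiff_descent (x p : V) (a s : R) :
  lower_semicontinuous f -> (ereal_inf (range f) < s%:E)%E ->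
  f x = a%:E -> s <= a -> convex_subdiff inner f x p ->
  exists y q, [/\ f y = s%:E, convex_subdiff inner f y q & `|q| <= `|p|].
Proof.
move=> f_lsc inf_lt fx; rewrite le_eqVlt => /predU1P[-> p_sub|sa p_sub].
  by exists x, p; rewrite fx lexx.
have [y /= fy_le y_proj] := projection ip x
  (lower_semicontinuous_sublevel_closed f_lsc) (sublevel_convex f_cvx (r := s))
  (sublevel_neq0 inf_lt).
pose d := x - y; pose l z := inner d (z - y).
have l_affine u v t : l (t *: u + (1 - t) *: v) = t * l u + (1 - t) * l v.
  rewrite /l -!(innerZr ip) -(innerDr ip); congr (inner _ _).
  by rewrite !scalerBr addrACA -opprD -scalerDl subrKC scale1r.
have l_concave u v t : 0 <= t <= 1 ->
    t * l u + (1 - t) * l v <= l (t *: u + (1 - t) *: v).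
  by move=> _; rewrite l_affine.
have lx : l x = `|d| ^+ 2 by rewrite /l -/d (innerxx ip).
have d_gt0 : 0 < `|d|.
  rewrite normr_gt0 subr_eq0; apply/eqP => xy.
  by move: fy_le; rewrite -xy fx lee_fin leNgt sa.
have lx_gt0 : 0 < l x by rewrite lx exprn_gt0.
have fx_lty : (f x < +oo)%E by rewrite fx ltry.
have s_le := sublevel_half_space f_cvx l_concave fx_lty lx_gt0 y_proj.
have [lam lam0 f_ge] := lagrange_multiplier f_cvx l_concave fx_lty lx_gt0 s_le.
have ly : l y = 0 by rewrite /l subrr (innerC ip) (inner0l ip).
have fy : f y = s%:E by apply/eqP; rewrite eq_le fy_le s_le// ly.
exists y, (lam *: d); split=> //.
  rewrite /convex_subdiff /= fy; split=> // z.
  by rewrite (innerZl ip) -EFinD f_ge.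
rewrite normrZ (ger0_norm lam0) -(ler_pM2r d_gt0) -mulrA -expr2 -lx.
apply: le_trans (inner_le_norm ip p d); have := f_ge x; rewrite fx lee_fin.
have [_ /(_ y)] := p_sub.
rewrite fx fy -EFinD lee_fin -opprB (innerNr ip) -/d; lra.
Qed.

End level_sets.

Theorem theorem4p4 (R : realType) (V : completeNormedModType R)
  (inner : V -> V -> R) (f : V -> \bar R) :
  is_inner_product inner ->
  lower_semicontinuous f -> proper_fun f -> convex_efun f ->
  ereal_inf (range f) = 0%E ->
  (exists r0 : R, 0 < r0 /\
     exists phi : R -> R, classK r0%:E phi /\
       forall x : V, (0 < f x)%E -> (f x <= r0%:E)%E ->
         (1 <= inf_norm (frechet_subdiff inner (compK r0%:E phi f) x))%E)
  <->
  (exists psi : R -> R, classK +oo%E psi /\ concave_on_nonneg psi /\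
     forall x : V, f x <> 0%E ->
       (1 <= inf_norm (frechet_subdiff inner (compK +oo%E psi f) x))%E).
Proof.
move=> ip f_lsc _ f_cvx inf0.
have f_ge0 x : (0 <= f x)%E by rewrite -inf0; apply: ereal_inf_lbound; exists x.
have chain := inf_norm_frechet_subdiff_compK_ge1P ip f_cvx f_ge0.
split=> [[r0 [r0_gt0 [phi [K phi_ge1]]]]|[psi [K [_ psi_ge1]]]]; last first.
  exists 1; split=> //; exists psi; have K1 := classK_restrict (leey 1%:E) K.
  split=> // x fx0 _; apply/(chain _ _ _ K1 fx0) => a q fx _ q_sub.
  have fx_neq0 : f x <> 0%E by apply/eqP; rewrite gt_eqF.
  exact: ((chain _ _ _ K fx0).1 (psi_ge1 x fx_neq0)) fx (ltry a) q_sub.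
have [psi [Kpsi psi_concave psi_ge1]] :=
  classK_concave_desingularization K r0_gt0.
exists psi; do 2 split=> //; move=> x /eqP fx_neq0.
have fx0 : (0 < f x)%E by rewrite lt_neqAle eq_sym fx_neq0 f_ge0.
apply/(chain _ _ _ Kpsi fx0) => a p fx _ p_sub.
apply: psi_ge1 => // [|s /andP[s0 sr0] sa]; first by rewrite -lte_fin -fx.
have inf_lt : (ereal_inf (range f) < s%:E)%E by rewrite inf0 lte_fin.
have [y [q [fy q_sub qp]]] :=
  convex_subdiff_descent ip f_cvx f_lsc inf_lt fx sa p_sub.
have [fy0 fyr] : (0 < f y)%E /\ (f y < r0%:E)%E by rewrite fy !lte_fin.
apply: le_trans (_ : derive1 phi s * `|q| <= _); last first.
  by rewrite ler_wpM2l// ltW// (classK_derive1_gt0 K).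
exact: ((chain _ _ _ K fy0).1 (phi_ge1 y fy0 (ltW fyr))).
Qed.
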